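(* For $n\ge0$ let $$\widehat Q_n=\sum_{\sigma\in\mathfrak S^{\rm ca}_{2n}} x_{\rm e}^{\mathrm{eareccpeakeven}(\sigma)}\,y_{\rm e}^{\mathrm{cvaleven}(\sigma)}\,u_{\rm e}^{\mathrm{nrcpeakeven}(\sigma)}\,x_{\rm o}^{\mathrm{eareccpeakodd}(\sigma)}\,y_{\rm o}^{\mathrm{cvalodd}(\sigma)}\,u_{\rm o}^{\mathrm{nrcpeakodd}(\sigma)}\,\lambda^{\mathrm{cyc}(\sigma)},$$ with indeterminates $x_{\rm e},y_{\rm e},u_{\rm e},x_{\rm o},y_{\rm o},u_{\rm o},\lambda$. Then, as formal power series in $t$, $\sum_{n\ge0}\widehat Q_n t^n=\cfrac{1}{1-\cfrac{\alpha_1 t}{1-\cfrac{\alpha_2 t}{1-\cdots}}}$ with, for all $k\ge1$, $\alpha_{2k-1}=(\lambda+2k-2)\,[x_{\rm e}+(2k-2)u_{\rm e}]\,y_{\rm o}$ and $\alpha_{2k}=(\lambda+2k-1)\,[x_{\rm o}+(2k-1)u_{\rm o}]\,y_{\rm e}$.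
   Context: For a permutation $\sigma$ of $[N]$, an index $i$ is a cycle peak if $\sigma^{-1}(i)<i>\sigma(i)$, a cycle valley if $\sigma^{-1}(i)>i<\sigma(i)$, a cycle double rise if $\sigma^{-1}(i)<i<\sigma(i)$, a cycle double fall if $\sigma^{-1}(i)>i>\sigma(i)$, a fixed point if $\sigma(i)=i$. $\sigma$ is cycle-alternating if it has no cycle double rises, cycle double falls or fixed points; $\mathfrak S^{\rm ca}_{2n}$ is the set of cycle-alternating permutations of $[2n]$. $\mathrm{cyc}(\sigma)$ is the number of cycles of $\sigma$. An index $i$ is an antirecord if $\sigma(j)>\sigma(i)$ for all $j>i$, a record if $\sigma(j)<\sigma(i)$ for all $j<i$; an exclusive antirecord is an antirecord that is not a record, and a neither-record-antirecord is an index that is neither. $\mathrm{eareccpeakeven}(\sigma)$ = number of even cycle peaks that are exclusive antirecords; $\mathrm{nrcpeakeven}(\sigma)$ = number of even cycle peaks that are neither-record-antirecords; $\mathrm{cvaleven}(\sigma)$ = number of even cycle valleys; the ''odd'' versions use odd indices. (In the paper this is the eight-variable cycle-counting polynomial with the valley variables specialized as $v_{\rm e}=y_{\rm e}$, $v_{\rm o}=y_{\rm o}$, so that every even (resp. odd) cycle valley gets weight $y_{\rm e}$ (resp. $y_{\rm o}$).) *)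

(* Defs.v *)
From HB Require Import structures.
From mathcomp Require Import all_boot all_order all_algebra all_fingroup.
From mathcomp Require Import mpoly.

Set Implicit Arguments.
Unset Strict Implicit.
Unset Printing Implicit Defensive.

Import GRing.Theory.

Section PermutationStatistics.

Variable N : nat.
Implicit Types (s : 'S_N) (i j : 'I_N).

(* The ordinal i stands for the index i + 1 of [N] = {1, ..., N}; only the
   parity of an index depends on this shift. *)
Definition idx_even i : bool := ~~ odd i.+1.
Definition idx_odd i : bool := odd i.+1.

Definition cpeak s i : bool := ((s^-1)%g i < i) && (i > s i).
Definition cval s i : bool := ((s^-1)%g i > i) && (i < s i).
Definition cdrise s i : bool := ((s^-1)%g i < i) && (i < s i).
Definition cdfall s i : bool := ((s^-1)%g i > i) && (i > s i).
Definition fixpt s i : bool := s i == i.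

Definition cycle_alternating s : bool :=
  [forall i, [&& ~~ cdrise s i, ~~ cdfall s i & ~~ fixpt s i]].

Definition record s i : bool := [forall j : 'I_N, (j < i) ==> (s j < s i)].
Definition antirecord s i : bool := [forall j : 'I_N, (i < j) ==> (s i < s j)].
Definition earec s i : bool := antirecord s i && ~~ record s i.
Definition nrar s i : bool := ~~ record s i && ~~ antirecord s i.

Definition eareccpeakeven s := #|[set i | [&& idx_even i, cpeak s i & earec s i]]|.
Definition eareccpeakodd s := #|[set i | [&& idx_odd i, cpeak s i & earec s i]]|.
Definition nrcpeakeven s := #|[set i | [&& idx_even i, cpeak s i & nrar s i]]|.
Definition nrcpeakodd s := #|[set i | [&& idx_odd i, cpeak s i & nrar s i]]|.
Definition cvaleven s := #|[set i | idx_even i && cval s i]|.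
Definition cvalodd s := #|[set i | idx_odd i && cval s i]|.

(* Fixed points count as cycles: porbits contains the singleton orbits. *)
Definition cyc s := #|porbits s|.

End PermutationStatistics.

Local Open Scope ring_scope.

Definition Qhat (R : comNzRingType) (xe ye ue xo yo uo lam : R) (n : nat) : R :=
  \sum_(s : 'S_(2 * n) | cycle_alternating s)
     xe ^+ eareccpeakeven s * ye ^+ cvaleven s * ue ^+ nrcpeakeven s *
     xo ^+ eareccpeakodd s * yo ^+ cvalodd s * uo ^+ nrcpeakodd s *
     lam ^+ cyc s.

(* A formal power series in t is its sequence of coefficients, multiplied by
   the Cauchy product (and not pointwise). *)
Section PowerSeries.

Variable R : comNzRingType.
Implicit Types f g : nat -> R.

Definition fps_one : nat -> R := fun n => (n == 0%N)%:R.

Definition fps_mul f g : nat -> R := fun n => \sum_(i < n.+1) f i * g (n - i)%N.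

(* 1 - a t f *)
Definition fps_one_sub_tmul (a : R) f : nat -> R :=
  fun n => if n is n'.+1 then - (a * f n') else 1.

(* The coefficients of 1/f of degrees n - 1, ..., 0, for f 0 = 1: the one of
   degree m is [m = 0] - \sum_(i < m) f_(i+1) (1/f)_(m-1-i). *)
Fixpoint fps_inv_coefs f (n : nat) : seq R :=
  if n is m.+1 then
    let r := fps_inv_coefs f m in
    ((m == 0%N)%:R - \sum_(i < m) f i.+1 * r`_i) :: r
  else [::].

Definition fps_inv f : nat -> R := fun n => head 0 (fps_inv_coefs f n.+1).

Lemma nth_fps_inv_coefs f n i :
  (i < n)%N -> (fps_inv_coefs f n)`_i = fps_inv f (n.-1 - i)%N.
Proof.
elim: n i => // n IHn [|i]; first by rewrite subn0.
rewrite ltnS => lt_in; rewrite [LHS]IHn //=.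
by congr fps_inv; rewrite -subn1 -subnDA add1n.
Qed.

Lemma fps_mulV f : f 0%N = 1 -> fps_mul f (fps_inv f) =1 fps_one.
Proof.
move=> f0 n; rewrite /fps_mul big_ord_recl f0 mul1r subn0 {1}/fps_inv /=.
under eq_bigr => i _ do rewrite nth_fps_inv_coefs //.
rewrite (eq_bigr (fun i : 'I_n => f i.+1 * fps_inv f (n - i.+1)%N)); last first.
  by move=> i _; rewrite -subn1 -subnDA add1n.
by rewrite subrK.
Qed.

(* 1/(1 - a_k t/(1 - a_(k+1) t/(1 - ... /(1 - a_(k+m-1) t)))) *)
Fixpoint sfrac_convergent (a : nat -> R) (m k : nat) : nat -> R :=
  if m is m'.+1 then
    fps_inv (fps_one_sub_tmul (a k) (sfrac_convergent a m' k.+1))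
  else fps_one.

(* f = 1/(1 - a_1 t/(1 - a_2 t/(1 - ...))) as the t-adic limit of the
   convergents; the value a 0 is not used. *)
Definition is_sfrac (a f : nat -> R) : Prop :=
  forall n : nat, exists M : nat, forall m : nat,
    (M <= m)%N -> sfrac_convergent a m 1 n = f n.

End PowerSeries.

Definition var_xe : {mpoly int[7]} := 'X_(inord 0).
Definition var_ye : {mpoly int[7]} := 'X_(inord 1).
Definition var_ue : {mpoly int[7]} := 'X_(inord 2).
Definition var_xo : {mpoly int[7]} := 'X_(inord 3).
Definition var_yo : {mpoly int[7]} := 'X_(inord 4).
Definition var_uo : {mpoly int[7]} := 'X_(inord 5).
Definition var_lam : {mpoly int[7]} := 'X_(inord 6).

(* Main.v *)
Require Import Defs.
From HB Require Import structures.
From mathcomp Require Import all_boot all_order all_algebra all_fingroup.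
From mathcomp Require Import mpoly.
From mathcomp Require Import zify ring.

(* Scan the indices of a cycle-alternating permutation in increasing order, and
   let h be the number of indices seen so far whose image is not yet seen.  A
   valley raises h by 1 and a peak lowers it by 1, which yields a Dyck path.  At
   a peak k reached from height h, both the preimage and the image of k are
   chosen among h candidates; exactly one of the h choices of the preimage
   closes a cycle, whatever the image, and k is an antirecord exactly when its
   image is the least candidate.  So the weights of the falls from height h add
   up to (lam + h - 1)(x + (h - 1)u), and since k and h have the same parity, x
   and u only depend on h.  The continued fraction enumerates the weighted Dyck
   paths (Flajolet). *)

Import GRing.Theory.

(** * Partial injections, extended by a valley or a peak *)

Section CycleAlternating.

Set Implicit Arguments.
Unset Strict Implicit.
Unset Printing Implicit Defensive.

Variable N : nat.
Implicit Types (s t : 'S_N) (a b j k : 'I_N) (i : nat) (A : {set 'I_N}).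

Lemma porbit_fix s a b : s b = b -> (a \in porbit s b) = (a == b).
Proof.
move=> sb; apply/porbitP/eqP => [[n ->] | ->]; last by exists 0; rewrite perm1.
by rewrite permX iter_fix.
Qed.

Lemma cyc1 : cyc (1 : 'S_N)%g = N.
Proof.
rewrite /cyc /porbits card_imset ?cardT ?size_enum_ord // => a b /setP/(_ a).
by rewrite !porbit_fix ?perm1 // eqxx => /esym/eqP.
Qed.

(* The permutations which restrict to the same partial injection of [0, i) as
   [t], opened at [A]: the elements of [A] are sent outside [0, i). *)
Definition opened_at i t A : pred 'S_N := fun s =>
  [forall j in A, i <= s j] &&
  [forall j : 'I_N, (j < i) && (j \notin A) ==> (s j == t j)].

Lemma opened_atP i t A s :
  reflect ({in A, forall j, i <= s j} /\
           forall j, j < i -> j \notin A -> s j = t j)%N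
          (opened_at i t A s).
Proof.
apply: (iffP andP) => [] [H1 H2]; split; first exact/forall_inP.
- by move=> j ji jA; apply/eqP/(implyP (forallP H2 j)); rewrite ji.
- exact/forall_inP.
- by apply/forallP => j; apply/implyP => /andP[ji jA]; rewrite H2.
Qed.

(* The map [f] witnesses that each cycle of [t] meets [A] at most once. *)
Definition scan_state i t A : Prop :=
  [/\ {in A, forall j, j < i}%N, forall j, (i <= j)%N -> t j = j
    & exists2 f : 'I_N -> 'I_N, forall j, f (t j) = f j & {in A, forall j, f j = j}].

Lemma scan_state0 : scan_state 0 1%g set0.
Proof.
split; [by move=> j; rewrite inE | by move=> j _; rewrite perm1 |].
by exists id => j; rewrite ?perm1 ?inE.
Qed.

Lemma scan_state_lt i t A j : scan_state i t A -> (t j < i)%N = (j < i)%N.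
Proof.
case=> _ tfix _; apply/idP/idP => [|ji]; rewrite !ltnNge.
  by apply: contra => ij; rewrite tfix.
by apply: contraL ji => ij; rewrite -leqNgt -(perm_inj (tfix _ ij)).
Qed.

(* Makes the images of [a], [k] and [b] equal to [k], [t b] and [t a]; the cycle
   of [a] is merged with that of [b], or just gains [k] if [a = b]. *)
Definition cycle_merge t a b k : 'S_N := (tperm a k * (tperm a b * t))%g.

Lemma cycle_mergeE t a b k j : t k = k -> a != k -> b != k ->
  cycle_merge t a b k j =
    if j == a then k else if j == k then t b else if j == b then t a else t j.
Proof.
move=> tk ak bk; rewrite !permM.
case: (eqVneq j a) => [->|ja]; first by rewrite tpermL tpermD.
case: (eqVneq j k) => [->|jk]; first by rewrite tpermR tpermL.
rewrite [tperm a k j]tpermD 1?eq_sym //.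
case: (eqVneq j b) => [->|jb]; first by rewrite tpermR.
by rewrite tpermD 1?eq_sym.
Qed.

Lemma scan_state_valley t A k :
  scan_state k t A -> scan_state k.+1 t (k |: A).
Proof.
move=> st; have [Alt tfix [f ft fA]] := st; split.
- by move=> j /setU1P[->|/Alt] //; lia.
- by move=> j kj; rewrite tfix // ltnW.
exists (fun j => if j == k then k else f j) => j /=.
  rewrite -{1}(tfix k (leqnn _)) (inj_eq perm_inj) ft.
  by case: eqP.
by case: eqP => [->|jk] // /setU1P[/jk|/fA].
Qed.

Lemma scan_state_peak t A k a b : scan_state k t A -> a \in A -> b \in A ->
  scan_state k.+1 (cycle_merge t a b k) (A :\ a).
Proof.
move=> st aA bA; have [Alt tfix [f ft fA]] := st.
have ak : a != k by rewrite neq_ltn Alt.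
have bk : b != k by rewrite neq_ltn Alt.
have tk := tfix k (leqnn _).
split.
- by move=> j /setD1P[_ /Alt]; lia.
- move=> j kj; rewrite cycle_mergeE // (tfix j (ltnW kj)).
  have [lt_a lt_b] := (Alt a aA, Alt b bA).
  have neq (l : 'I_N) : (l <= k)%N -> (j == l) = false.
    by move=> lk; apply/negbTE; rewrite neq_ltn (leq_ltn_trans lk) ?orbT.
  by rewrite !neq // ltnW.
(* The index [k] and the former cycle of [a] join the cycle of [b], so they take its label [b]. *)
exists (fun j => if (f j == a) || (j == k) then b else f j) => j /=; last first.
  case/setD1P=> ja jA; rewrite fA // (negbTE ja) /=.
  by case: eqP => // E; have := Alt j jA; rewrite E ltnn.
rewrite cycle_mergeE //.
case: (eqVneq j a) => [->|ja]; first by rewrite eqxx orbT fA // eqxx.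
case: (eqVneq j k) => [->|jk]; first by rewrite ft fA // orbT; case: ifP.
case: (eqVneq j b) => [->|jb].
  by rewrite ft !fA // eqxx /=; case: ifP.
by rewrite ft -[X in t j == X]tk (inj_eq perm_inj) (negbTE jk).
Qed.

(** A transposition that joins two cycles lowers their number by one: [tperm a k] always does, as
    [k] is still a fixed point, and [tperm a b] does unless [a = b], as distinct elements of [A] lie
    in distinct cycles. *)
Lemma cyc_cycle_merge t A k a b : scan_state k t A -> a \in A -> b \in A ->
  (cyc (cycle_merge t a b k) + (a != b).+1 = cyc t)%N.
Proof.
move=> [Alt tfix [f ft fA]] aA bA.
have ak : a != k by rewrite neq_ltn Alt.
have bk : b != k by rewrite neq_ltn Alt.
have tk := tfix k (leqnn _).
have ab : (a \in porbit t b) = (a == b).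
  apply/idP/eqP => [/porbitP[n abn] | ->]; last exact: porbit_id.
  rewrite -[RHS]fA // -[LHS]fA // abn.
  by elim: n {abn} => [|n IHn]; rewrite ?perm1 // expgSr permM ft.
pose r : 'S_N := (tperm a b * t)%g.
have E1 : cyc r + (a != b).*2 = cyc t + (a != b).
  by have := porbits_mul_tperm t a b; rewrite ab.
have E2 : cyc (cycle_merge t a b k) + 1.*2 = cyc r + 1.
  have := porbits_mul_tperm r a k.
  by rewrite porbit_fix ?permM ?tpermD // ak.
by move: E1 E2; case: (a == b) => /=; lia.
Qed.

(** Once [k] is open, no index up to [k] has image [k]: those in [k |: A] are sent beyond [k], and
    the others keep their images under [t], which are below [k]. *)
Lemma opened_at_valley t A k s : scan_state k t A ->
  opened_at k t A s && cval s k = opened_at k.+1 t (k |: A) s.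
Proof.
move=> st; have [Alt tfix _] := st.
have tk := tfix k (leqnn _).
apply/andP/opened_atP => [[/opened_atP[sA sE] /andP[vk ks]] | [sA sE]].
  split=> [j /setU1P[->|jA] // | j jk]; last first.
    rewrite !inE negb_or => /andP[jk' jA]; apply: sE => //.
    by rewrite ltn_neqAle -ltnS jk' jk.
  rewrite ltn_neqAle sA // andbT; apply: contraTN vk => /eqP E.
  by rewrite (val_inj E : k = s j) permK; have := Alt j jA; lia.
split.
  apply/opened_atP; split => [j jA | j jk jA].
    by apply: ltnW; apply: sA; rewrite !inE jA orbT.
  by apply: sE; rewrite ?ltnS 1?ltnW // !inE negb_or jA andbT neq_ltn jk.
have sk : (k < s k)%N by apply: sA; rewrite !inE eqxx.
rewrite /cval sk andbT ltnNge; apply/negP => le_k.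
have sj := permKV s k; set j := (s^-1)%g k in le_k sj.
have [jA|jA] := boolP (j \in k |: A).
  by have := sA _ jA; rewrite sj ltnn.
move: (sE j le_k jA); rewrite sj => /esym; rewrite -tk => /perm_inj E.
by move: sk; rewrite -[X in s X]E sj ltnn.
Qed.

(** The values below [k] that [s] does not take on the indices below [k] are the [t b] with [b] in
    [A], so a candidate for the image of [k] is coded by its [b]. *)
Lemma opened_at_peak_mem t A k s : scan_state k t A ->
  opened_at k t A s -> cpeak s k ->
  ((s^-1)%g k \in A) && ((t^-1)%g (s k) \in A).
Proof.
move=> st /opened_atP[sA sE] /andP[ak bk]; have [Alt tfix _] := st.
have tk := tfix k (leqnn _).
apply/andP; split; apply/negPn/negP => nA.
  move: (sE _ ak nA); rewrite permKV -{1}tk => /perm_inj E.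
  by move: ak; rewrite -E ltnn.
have tb := permKV t (s k); set b := (t^-1)%g (s k) in nA tb.
have lt_bk : (b < k)%N by rewrite -(scan_state_lt b st) tb.
move: (sE _ lt_bk nA); rewrite tb => /perm_inj E.
by move: lt_bk; rewrite E ltnn.
Qed.

Lemma opened_at_peak t A k a b s : scan_state k t A -> a \in A -> b \in A ->
  [&& opened_at k t A s, cpeak s k
    & ((s^-1)%g k, (t^-1)%g (s k)) == (a, b)] =
  opened_at k.+1 (cycle_merge t a b k) (A :\ a) s.
Proof.
move=> st aA bA; have [Alt tfix _] := st.
have ak : a != k by rewrite neq_ltn Alt.
have bk : b != k by rewrite neq_ltn Alt.
have tk := tfix k (leqnn _).
apply/and3P/opened_atP => [[/opened_atP[sA sE] _ /eqP[Ea Eb]] | [sA sE]].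
  have sa : s a = k by rewrite -Ea permKV.
  have sk : s k = t b by rewrite -Eb permKV.
  split=> [j /setD1P[ja jA] | j].
    rewrite ltn_neqAle sA // andbT; apply: contra ja => /eqP E.
    by rewrite -Ea (val_inj E : k = s j) permK.
  rewrite ltnS leq_eqVlt cycle_mergeE // !inE negb_and negbK.
  case: (eqVneq j a) => [->|ja] //=.
  case: (eqVneq j k) => [->|jk] //= jk' jA.
  rewrite sE //; last by move/orP: jk' => [/eqP/val_inj E|//]; rewrite E eqxx in jk.
  by case: (eqVneq j b) jA => [->|] //; rewrite bA.
have sa : s a = k.
  by rewrite sE ?cycle_mergeE ?inE ?eqxx // ltnS ltnW ?Alt.
have sk : s k = t b.
  rewrite sE ?cycle_mergeE ?inE ?eqxx //; first by rewrite eq_sym (negbTE ak).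
  by apply/negP => /andP[_ /Alt]; rewrite ltnn.
split.
- apply/opened_atP; split => [j jA | j jk jA].
    have [->|ja] := eqVneq j a; first by rewrite sa.
    by apply/ltnW/sA; rewrite !inE ja.
  rewrite sE; last 2 first.
  + by rewrite ltnS ltnW.
  + by rewrite !inE (negbTE jA) andbF.
  rewrite cycle_mergeE //.
  case: eqP => [E|_]; first by rewrite E aA in jA.
  case: eqP => [E|_]; first by rewrite E ltnn in jk.
  by case: eqP => [E|_] //; rewrite E bA in jA.
- by rewrite /cpeak -{1}sa permK sk (scan_state_lt _ st) !Alt.
- by rewrite -{1}sa permK sk permK.
Qed.

(** Every candidate other than [s k] is the image of an index after [k], and the indices after [k]
    have no other images below [k]. *)
Lemma opened_at_antirecord t A k b s : scan_state k t A -> b \in A ->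
  opened_at k t A s -> s k = t b ->
  antirecord s k = [forall j in A, t b <= t j].
Proof.
move=> st bA /opened_atP[sA sE] sk; have [Alt tfix _] := st.
apply/forall_inP/forall_inP => [ar j jA | tmin j kj].
  have sj := permKV s (t j); set l := (s^-1)%g (t j) in sj.
  have := ar l; case: (ltngtP k l) => [kl| lk | /val_inj kl] arl.
  - by rewrite -sj -sk ltnW ?arl.
  - have [lA|lA] := boolP (l \in A).
      by have := sA l lA; rewrite sj leqNgt (scan_state_lt _ st) Alt.
    by move: (sE l lk lA); rewrite sj => /perm_inj E; rewrite -E jA in lA.
  - by rewrite -sj -kl sk.
rewrite ltnNge; apply/negP => le_s.
have tl := permKV t (s j); set l := (t^-1)%g (s j) in tl.
have lk : (l < k)%N.
  rewrite -(scan_state_lt l st) tl (leq_ltn_trans le_s) // sk.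
  by rewrite (scan_state_lt _ st) Alt.
have [lA|lA] := boolP (l \in A).
  have := tmin l lA; rewrite tl -sk => ge_s.
  have /val_inj/perm_inj E : s j = s k :> nat by lia.
  by move: kj; rewrite E ltnn.
by move: (sE l lk lA); rewrite tl => /perm_inj E; move: lk; rewrite E; lia.
Qed.

End CycleAlternating.

Local Open Scope ring_scope.

(** * Stieltjes continued fractions and weighted Dyck paths *)

Section Paths.

Set Implicit Arguments.
Unset Strict Implicit.
Unset Printing Implicit Defensive.

Variable R : comNzRingType.
Implicit Types (f g u d a : nat -> R).

(** Truncation transfers the associativity of polynomial multiplication to [fps_mul]. *)
Lemma fps_mul_coef N f g n : (n < N)%N ->
  fps_mul f g n = (\poly_(i < N) f i * \poly_(i < N) g i)`_n.
Proof.
move=> ltnN; rewrite coefM; apply: eq_bigr => i _.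
rewrite !coef_poly (leq_ltn_trans _ ltnN) ?(leq_ltn_trans _ ltnN) ?leq_subr //.
by rewrite -ltnS.
Qed.

Lemma fps_mulA f g h n : fps_mul f (fps_mul g h) n = fps_mul (fps_mul f g) h n.
Proof.
pose P f' := \poly_(i < n.+1) (f' i : R).
transitivity ((P f * (P g * P h))`_n).
  rewrite coefM; apply: eq_bigr => i _.
  by rewrite coef_poly ltn_ord (@fps_mul_coef n.+1) // ltnS leq_subr.
rewrite mulrA coefM; apply: eq_bigr => i _.
by rewrite coef_poly ltnS leq_subr (@fps_mul_coef n.+1).
Qed.

Lemma fps_inv0 f : fps_inv f 0 = 1.
Proof. by rewrite /fps_inv /= big_ord0 subr0. Qed.

(** Compares coefficients in [F = 1 + b t F g]. *)
Lemma fps_inv_one_sub_tmulS (b : R) g n (F := fps_inv (fps_one_sub_tmul b g)) :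
  F n.+1 = b * fps_mul F g n.
Proof.
rewrite {}/F; have /(_ n.+1) := fps_mulV (f := fps_one_sub_tmul b g) erefl.
rewrite /fps_mul big_ord_recl /= mul1r subn0 => /(canRL (addrK _)) ->.
rewrite add0r -sumrN mulr_sumr [RHS](reindex_inj rev_ord_inj) /=.
apply: eq_bigr => i _; rewrite mulNr opprK subSS -mulrA; congr (_ * _).
by rewrite subKn 1?mulrC // -ltnS.
Qed.

(* Weighted sum over the Dyck-type paths with [m] steps from height [h] to
   height 0: a rise to height [k] weighs [u k], a fall from it weighs [d k]. *)
Fixpoint dyck u d (m h : nat) : R :=
  if m is m'.+1 then
    u h.+1 * dyck u d m' h.+1 + (if h is h'.+1 then d h * dyck u d m' h' else 0)
  else (h == 0%N)%:R.

(** With [F_h] the tail of the continued fraction at level [h], this is [F_0 F_1 ... F_h]; the depth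
    [M - h] makes all tails stop at [a M]. *)
Fixpoint sfrac_tail_prod a M h : nat -> R :=
  let F := sfrac_convergent a (M - h) h.+1 in
  if h is h'.+1 then fps_mul (sfrac_tail_prod a M h') F else F.

Lemma sfrac_convergent0 a m k : sfrac_convergent a m k 0 = 1.
Proof. by case: m => [|m] //=; rewrite fps_inv0. Qed.

Lemma sfrac_convergentS a M h n (F := fun h => sfrac_convergent a (M - h) h.+1) :
  (h < M)%N -> F h n.+1 = a h.+1 * fps_mul (F h) (F h.+1) n.
Proof. by move=> ltnM; rewrite /F -(subnSK ltnM) -fps_inv_one_sub_tmulS. Qed.

Lemma sfrac_tail_prod0 a M h : sfrac_tail_prod a M h 0 = 1.
Proof.
elim: h => [|h IHh] /=; first exact: sfrac_convergent0.
by rewrite /fps_mul big_ord1 IHh sfrac_convergent0 mul1r.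
Qed.

(** Multiplying [F_h = 1 + a_(h+1) t F_h F_(h+1)] by [F_0 ... F_(h-1)] gives a recurrence of the
    same shape as the first-step recurrence of [dyck]. *)
Lemma sfrac_tail_prodS a M h n (G := sfrac_tail_prod a M) : (h < M)%N ->
  G h n.+1 = a h.+1 * G h.+1 n + (if h is h'.+1 then G h' n.+1 else 0).
Proof.
rewrite {}/G; case: h => [|h] ltnM; first by rewrite addr0 /= sfrac_convergentS.
rewrite [LHS]/= [in LHS]/fps_mul big_ord_recr /= subnn sfrac_convergent0 mulr1.
congr (_ + _); rewrite -fps_mulA mulr_sumr; apply: eq_bigr => i _.
have le_in : (i <= n)%N by rewrite -ltnS.
rewrite subSn //; have -> := sfrac_convergentS a (n - i) ltnM.
by rewrite mulrCA.
Qed.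

Lemma dyckS u d m h :
  dyck u d m.+1 h =
    u h.+1 * dyck u d m h.+1 + (if h is h'.+1 then d h * dyck u d m h' else 0).
Proof. by []. Qed.

Lemma dyck_gt u d m h : (m < h)%N -> dyck u d m h = 0.
Proof.
elim: m h => [|m IHm] [|h] //= lt_mh.
by rewrite !IHm ?mulr0 ?addr0 //; lia.
Qed.

(* Cutting a path from height [h] at its last visits to the heights
   [h, ..., 1] yields [h + 1] Dyck paths, with base levels [h, ..., 0]. *)
Lemma dyck_sfrac_tail_prod a u d M h n :
    (forall k, a k.+1 = u k.+1 * d k.+1) -> (h + n <= M)%N ->
  dyck u d (h + n.*2) h = (\prod_(j < h) d j.+1) * sfrac_tail_prod a M h n.
Proof.
(* The induction is on the path length, which a first step lowers by one. For [n = 0] a rise leaves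
   too few steps to come back to height 0. *)
move=> aE; have [L] := ubnP (h + n.*2)%N; elim: L h n => // L IHL [|h] [|n] ltL leM.
- by rewrite big_ord0 sfrac_tail_prod0 mulr1.
- have E1 := IHL 1%N n ltac:(lia) ltac:(lia).
  rewrite sfrac_tail_prodS; last by lia.
  have -> : (0 + n.+1.*2 = (1 + n.*2).+1)%N by lia.
  by rewrite big_ord0 mul1r dyckS !addr0 E1 big_ord1 aE mulrA.
- have E0 := IHL h 0%N ltac:(lia) ltac:(lia).
  have -> : (h.+1 + 0.*2 = (h + 0.*2).+1)%N by lia.
  rewrite dyckS E0 dyck_gt; last by lia.
  by rewrite !sfrac_tail_prod0 big_ord_recr mulr0 add0r !mulr1 mulrC.
have E1 := IHL h n.+1 ltac:(lia) ltac:(lia).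
have E2 := IHL h.+2 n ltac:(lia) ltac:(lia).
rewrite sfrac_tail_prodS; last by lia.
have -> : (h.+1 + n.+1.*2 = (h.+2 + n.*2).+1)%N by lia.
rewrite dyckS E2; have -> : (h.+2 + n.*2 = h + n.+1.*2)%N by lia.
rewrite E1 aE !big_ord_recr /=.
set p := \prod_(_ < _) _; ring.
Qed.

Lemma is_sfrac_dyck a u d : (forall k, a k.+1 = u k.+1 * d k.+1) ->
  is_sfrac a (fun n => dyck u d (2 * n) 0).
Proof.
(* A path of [2 * n] steps stays at height at most [n], so it only meets the levels up to [a n]. *)
move=> aE n; exists n => m lenm.
have := @dyck_sfrac_tail_prod a u d m 0 n aE lenm.
by rewrite mul2n add0n big_ord0 mul1r /= subn0.
Qed.

End Paths.

(** * Weights of the permutations along the scan *)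

Section WeightedSum.

Set Implicit Arguments.
Unset Strict Implicit.
Unset Printing Implicit Defensive.

Variables (R : comNzRingType) (xe ye ue xo yo uo lam : R).

Definition rise_weight (h : nat) : R := if odd h then yo else ye.

Definition fall_weight (h : nat) : R :=
  (lam + h.-1%:R) *
  ((if odd h then xe else xo) + h.-1%:R * (if odd h then ue else uo)).

Variable N : nat.
Implicit Types (s t : 'S_N) (a b j k : 'I_N) (i : nat) (A : {set 'I_N}).

(** An odd ordinal stands for an even index. As a peak is never a record, being an antirecord or not
    decides between [x] and [u]. *)
Definition peak_weight (i : nat) (ar : bool) : R :=
  if odd i then (if ar then xe else ue) else (if ar then xo else uo).

Definition index_weight s j : R :=
  if cval s j then rise_weight j.+1 else peak_weight j (antirecord s j).

Definition alternates_from i s :=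
  [forall j : 'I_N, (i <= j)%N ==> cpeak s j || cval s j].

Definition scan_sum i t A : R :=
  \sum_(s | opened_at i t A s && alternates_from i s)
     (\prod_(j : 'I_N | (i <= j)%N) index_weight s j) * lam ^+ cyc s.

Lemma alternates_fromS k s :
  alternates_from k s = (cpeak s k || cval s k) && alternates_from k.+1 s.
Proof.
apply/forallP/andP => [H | [Hk /forallP H] j].
  split; first exact: (implyP (H k)).
  by apply/forallP => j; apply/implyP => kj; apply: (implyP (H j)); apply: ltnW.
by rewrite leq_eqVlt; apply/implyP => /orP[/eqP/val_inj <-|] //; apply/implyP.
Qed.

Lemma cpeak_not_cval s j : cpeak s j -> cval s j = false.
Proof. by case/andP=> lt_j _; rewrite /cval ltnNge ltnW. Qed.

Lemma sum_min_at (K : {set 'I_N}) (t : 'S_N) (x u : R) b : b \in K ->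
  \sum_(a in K) (if [forall j in K, t a <= t j]%N then x else u) =
  x + (#|K|.-1)%:R * u.
Proof.
move=> bK; case: (arg_minnP (fun j => t j : nat) bK) => a aK amin.
move: aK => /= aK; have {}aK : a \in K := aK.
rewrite (bigD1 a) //= ifT; last exact/forall_inP.
congr (_ + _); rewrite mulr_natl (cardsD1 a) aK /= -sumr_const.
apply: eq_big => [j|j /andP[jK ja]]; first by rewrite !inE andbC.
rewrite ifF //; apply: contraNF ja => /forall_inP /(_ a aK) le_ja.
by rewrite -(inj_eq (@perm_inj _ t)) -val_eqE /= eqn_leq le_ja amin.
Qed.

Lemma sum_eq_at (K : {set 'I_N}) (z : R) b c : b \in K ->
  \sum_(a in K) z ^+ (c + (a == b)) = z ^+ c * (z + (#|K|.-1)%:R).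
Proof.
move=> bK; rewrite (bigD1 b) //= eqxx addn1 exprSr mulrDr; congr (_ + _).
rewrite mulr_natr (cardsD1 b) bK /= -sumr_const.
apply: eq_big => [j|j /andP[jK /negbTE ->]]; first by rewrite !inE andbC.
by rewrite addn0.
Qed.

(** Here [c] counts the cycles already closed: the other cycles of [t] are the open ones, one per
    element of [A], and the [m] fixed points still to be scanned. *)
Lemma scan_sum_eq m i t A c :
    (i + m = N)%N -> scan_state i t A -> odd #|A| = odd i ->
    (cyc t = c + #|A| + m)%N ->
  scan_sum i t A = lam ^+ c * dyck rise_weight fall_weight m #|A|.
Proof.
elim: m i t A c => [|m IHm] i t A c imN st odd_A cyc_t.
  have iN : i = N by rewrite -imN addn0.
  subst i; rewrite /scan_sum /=.
  (* At the end of the scan [t] itself is the only permutation if nothing is open; otherwise there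
     is none, and [dyck] vanishes at positive height. *)
  have [A0|[a aA]] := set_0Vmem A.
    rewrite A0 cards0 eqxx mulr1 (big_pred1 t) => [|s].
      rewrite big1 ?mul1r => [|j]; last by rewrite leqNgt ltn_ord.
      by rewrite cyc_t A0 cards0 !addn0.
    have -> : alternates_from N s.
      by apply/forallP => j; rewrite leqNgt ltn_ord.
    rewrite andbT /=; apply/opened_atP/eqP => [[_ sE]|->]; last first.
      by split=> // j; rewrite inE.
    by apply/permP => j; rewrite sE ?inE.
  rewrite big1 => [|s /andP[/opened_atP[sA _] _]].
    by rewrite (cardsD1 a) aA mulr0.
  by have := sA a aA; rewrite leqNgt ltn_ord.
have lt_iN : (i < N)%N by lia.
have [k ik] : exists k : 'I_N, i = k :> nat by exists (Ordinal lt_iN).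
subst i.
have W s : \prod_(j : 'I_N | (k <= j)%N) index_weight s j =
           index_weight s k * \prod_(j : 'I_N | (k < j)%N) index_weight s j.
  rewrite (bigD1 k) //=; congr (_ * _); apply: eq_bigl => j.
  by rewrite ltn_neqAle andbC -val_eqE eq_sym.
have [Alt _ _] := st.
have kA : k \notin A by apply/negP => /Alt; rewrite ltnn.
rewrite /scan_sum (bigID (fun s => cval s k)) /= mulrDr; congr (_ + _).
  transitivity (rise_weight k.+1 * scan_sum k.+1 t (k |: A)).
    rewrite mulr_sumr; apply: eq_big => [s|s /andP[_ vk]].
      rewrite -opened_at_valley // alternates_fromS.
      by case: (cval s k); rewrite ?orbT ?andbF ?andbT.
    by rewrite W /index_weight vk !mulrA.
  rewrite (IHm _ _ _ c) ?cardsU1 ?kA //.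
  + rewrite add1n mulrCA; congr (_ * (_ * _)).
    by rewrite /rise_weight /= odd_A.
  + by rewrite addSnnS.
  + exact: scan_state_valley.
  + by rewrite add1n /= odd_A.
  + by rewrite cyc_t; lia.
(* The peaks at [k] are sorted by the preimage [a] of [k] and by its image [t b]. *)
transitivity (\sum_(a in A) \sum_(b in A)
    (if [forall j in A, t b <= t j]%N then peak_weight k true else peak_weight k false)
    * scan_sum k.+1 (cycle_merge t a b k) (A :\ a)).
  rewrite (partition_big (fun s => ((s^-1)%g k, (t^-1)%g (s k)))
     (fun q => (q.1 \in A) && (q.2 \in A))) /=; last first.
    move=> s /andP[/andP[op]]; rewrite alternates_fromS => /andP[+ _] vk.
    by rewrite (negbTE vk) orbF; apply: opened_at_peak_mem.
  rewrite [RHS]pair_big /=; apply: eq_bigr => -[a b] /= /andP[aA bA].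
  rewrite mulr_sumr; apply: eq_big => [s | s /andP[/andP[/andP[op alt] vk] /eqP[_ Eb]]].
    rewrite -opened_at_peak // alternates_fromS.
    have := @cpeak_not_cval s k; case: (cpeak s k) => [->//|_] /=.
      by rewrite -!andbA; do !bool_congr.
    by case: (cval s k); rewrite ?andbF.
  rewrite W /index_weight (negbTE vk) (opened_at_antirecord st bA) //.
    by case: ifP => _; rewrite mulrA.
  by rewrite -Eb permKV.
have [A0|[a0 a0A]] := set_0Vmem A.
  by rewrite A0 cards0 mulr0 big_set0.
have cardA : #|A| = (#|A|.-1).+1 by rewrite (cardsD1 a0) a0A.
(* For a fixed image, the sum over the preimages gives the cycle factor, which does not depend on
   [b]; the sum over [b] then gives the antirecord factor. *)
rewrite exchange_big /=.
transitivity (\sum_(b in A)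
    (if [forall j in A, t b <= t j]%N then peak_weight k true else peak_weight k false)
    * (lam ^+ c * (lam + (#|A|.-1)%:R) * dyck rise_weight fall_weight m #|A|.-1)).
  apply: eq_bigr => b bA; rewrite -mulr_sumr; congr (_ * _).
  rewrite -(sum_eq_at _ _ bA) mulr_suml; apply: eq_bigr => a aA.
  have cardAa : #|A :\ a| = #|A|.-1 by rewrite (cardsD1 a A) aA.
  rewrite (IHm _ _ _ (c + (a == b))%N) ?cardAa //.
  + by rewrite addSnnS.
  + exact: scan_state_peak.
  + by move: odd_A; rewrite {1}cardA /=; case: (odd _); case: (odd _).
  + by have := cyc_cycle_merge st aA bA; rewrite cyc_t {1}cardA; case: (a == b) => /=; lia.
rewrite -mulr_suml (sum_min_at _ _ _ a0A).
rewrite [X in _ = _ * X](_ : _ = fall_weight #|A| *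
    dyck rise_weight fall_weight m #|A|.-1); last by rewrite {1 2 3}cardA.
rewrite /fall_weight /peak_weight odd_A; case: (odd k); ring.
Qed.

Lemma cycle_alternatingE s : cycle_alternating s = alternates_from 0 s.
Proof.
apply: eq_forallb => j; rewrite /cdrise /cdfall /fixpt /cpeak /cval /=.
rewrite -val_eqE /=; case: (ltngtP (s j) j) => [lt|gt|E] /=; rewrite ?andbT ?andbF //=.
- case: (ltngtP ((s^-1)%g j) j) => //= /val_inj E.
  by move: lt; rewrite -{1}E permKV ltnn.
- case: (ltngtP ((s^-1)%g j) j) => //= /val_inj E.
  by move: gt; rewrite -{2}E permKV ltnn.
Qed.

Lemma cpeak_not_record s j : cpeak s j -> ~~ record s j.
Proof.
case/andP=> lt_aj gt_j; apply/negP => /forall_inP /(_ _ lt_aj).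
by rewrite permKV ltnNge ltnW.
Qed.

Lemma exp_card_set (P : pred 'I_N) (x : R) :
  x ^+ #|[set j | P j]| = \prod_j (if P j then x else 1).
Proof. by rewrite -prodr_const big_mkcond; apply: eq_bigr => j _; rewrite inE. Qed.

Lemma index_weight_prod s : cycle_alternating s ->
  xe ^+ eareccpeakeven s * ye ^+ cvaleven s * ue ^+ nrcpeakeven s *
  xo ^+ eareccpeakodd s * yo ^+ cvalodd s * uo ^+ nrcpeakodd s =
  \prod_j index_weight s j.
Proof.
rewrite cycle_alternatingE => /forallP alt.
rewrite !exp_card_set -!big_split /=; apply: eq_bigr => j _.
have := implyP (alt j) isT; rewrite /index_weight /rise_weight /peak_weight.
rewrite /idx_even /idx_odd /earec /nrar /= negbK.
have [pj|] := boolP (cpeak s j).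
  rewrite (cpeak_not_cval pj) (cpeak_not_record pj) => _ /=.
  by case: (odd j); case: (antirecord s j); rewrite /= ?mul1r ?mulr1.
by move=> _ /= ->; case: (odd j); rewrite /= ?mul1r ?mulr1.
Qed.

End WeightedSum.

(** * From the full scan to the continued fraction *)

Lemma Qhat_dyck (R : comNzRingType) (xe ye ue xo yo uo lam : R) n :
  Qhat xe ye ue xo yo uo lam n =
  dyck (rise_weight ye yo) (fall_weight xe ue xo uo lam) (2 * n) 0.
Proof.
have st := @scan_state0 (2 * n).
have cyc_1 : cyc (1 : 'S_(2 * n))%g = (0 + #|@set0 'I_(2 * n)| + 2 * n)%N.
  by rewrite cyc1 cards0.
have := scan_sum_eq xe ye ue xo yo uo lam (add0n _) st _ cyc_1.
rewrite cards0 mul1r => <- //; apply: eq_big => [s|s /index_weight_prod ->].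
  rewrite cycle_alternatingE; case: opened_atP => // -[].
  by split=> j; rewrite ?inE.
by congr (_ * _); apply: eq_bigl => j; rewrite leq0n.
Qed.

Theorem theorem5p1 (alpha : nat -> {mpoly int[7]})
  (alpha_odd : forall k : nat, (1 <= k)%N ->
     alpha (2 * k - 1)%N =
       (var_lam + (2 * k - 2)%N%:R) * (var_xe + (2 * k - 2)%N%:R * var_ue) * var_yo)
  (alpha_even : forall k : nat, (1 <= k)%N ->
     alpha (2 * k)%N =
       (var_lam + (2 * k - 1)%N%:R) * (var_xo + (2 * k - 1)%N%:R * var_uo) * var_ye) :
  is_sfrac alpha
    (Qhat var_xe var_ye var_ue var_xo var_yo var_uo var_lam).
Proof.
pose y := rise_weight var_ye var_yo.
pose d := fall_weight var_xe var_ue var_xo var_uo var_lam.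
(* Level [k.+1] pairs the rise to height [k.+1] with the fall from it; the parity of [k] selects the
   formula for [alpha]. *)
have alphaE k : alpha k.+1 = y k.+1 * d k.+1.
  rewrite /y /d /rise_weight /fall_weight mulrC /=.
  have [odd_k|even_k] := boolP (odd k) => /=.
    have kE : (2 * k.+1./2 = k.+1)%N by lia.
    by have := alpha_even k.+1./2 ltac:(lia); rewrite kE subn1.
  have kE : (2 * (k./2).+1 = k.+2)%N by lia.
  by have := alpha_odd (k./2).+1 isT; rewrite kE subn1 subn2.
move=> n; have [M HM] := is_sfrac_dyck alphaE n.
by exists M => m /HM ->; rewrite Qhat_dyck.
Qed.
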